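(* Let $M$ be an $n$-dimensional Riemannian manifold. Then $M$ is a D'Atri space of type $k$ for all $k=1,\dots,n-1$ if and only if $M$ is an $\mathfrak{SC}$-space.
   Context: For $m\in M$, a unit vector $v\in T_mM$ and small $t>0$, let $\gamma_v$ be the geodesic with $\gamma_v(0)=m$, $\gamma_v'(0)=v$, and let $S_v(t)$ be the shape operator at $\gamma_v(t)$, with respect to the outward unit normal $\gamma_v'(t)$, of the geodesic sphere $G_m(t)=\{\exp_m(tw):w\in T_mM,|w|=1\}$. The local geodesic symmetry $s_m$ is $\exp_m(x)\mapsto\exp_m(-x)$, so $s_m(\gamma_v(t))=\gamma_v(-t)=\gamma_{-v}(t)$. Let $\sigma_k(A)$ denote the $k$-th elementary symmetric function of the eigenvalues (with multiplicity) of a symmetric endomorphism $A$. $M$ is a D'Atri space of type $k$ ($1\le k\le n-1$) if for each $m\in M$ and each small $t>0$, $\sigma_k(S_v(t))=\sigma_k(S_{-v}(t))$ for all unit $v\in T_mM$. $M$ is an $\mathfrak{SC}$-space if, for all $m\in M$, the geodesic symmetry $s_m$ preserves the eigenvalues (principal curvatures) of the shape operators of small geodesic spheres centered at $m$; that is, for small $t>0$ and all unit $v\in T_mM$, $S_v(t)$ and $S_{-v}(t)$ have the same eigenvalues counted with multiplicities. *)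

(* Defs.v *)
From HB Require Import structures.
From mathcomp Require Import all_boot all_order all_algebra.
From mathcomp Require Import all_classical all_reals all_analysis.
From mathcomp Require Import complex.
Set Implicit Arguments.
Unset Strict Implicit.
Unset Printing Implicit Defensive.
Import Order.TTheory GRing.Theory Num.Theory.
Import numFieldNormedType.Exports.
Local Open Scope classical_set_scope.
Local Open Scope ring_scope.

(* For U open, [Ck k U f] says that f is of class C^k on U: each step asks for
   differentiability together with C^k directional derivatives. *)
Fixpoint Ck (R : realType) (V W : normedModType R) (k : nat) (U : set V)
    (f : V -> W) : Prop :=
  if k is k'.+1 then
    (forall x, U x -> differentiable f x) /\
    (forall v : V, Ck k' U (fun x => 'D_v f x))
  else forall x, U x -> {for x, continuous f}.

Definition smooth (R : realType) (V W : normedModType R) (U : set V)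
    (f : V -> W) : Prop :=
  forall k, Ck k U f.

(* Vectors of R^n are row vectors, so that a linear map acts by right
   multiplication; in particular ['J f x] is applied as [u *m 'J f x]. *)
Record chart (R : realType) (n : nat) (M : topologicalType) := Chart {
  cdom : set M;
  cmap : M -> 'rV[R]_n;
  cinv : 'rV[R]_n -> M;
  cdom_open : open cdom;
  cimage_open : open (cmap @` cdom);
  cmap_continuous : forall p, cdom p -> {for p, continuous cmap};
  cinv_continuous :
    forall x, (cmap @` cdom) x -> {for x, continuous cinv};
  cmapK : forall p, cdom p -> cinv (cmap p) = p }.

Record smooth_manifold (R : realType) (n : nat) := SmoothManifold {
  carrier :> topologicalType;
  carrier_hausdorff : hausdorff_space carrier;
  carrier_second_countable : @second_countable carrier;
  chart_index : Type;
  charts : chart_index -> chart R n carrier;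
  chart_at : carrier -> chart_index;
  chart_atP : forall p, cdom (charts (chart_at p)) p;
  transition_smooth : forall i j,
    smooth (cmap (charts i) @` (cdom (charts i) `&` cdom (charts j)))
      (cmap (charts j) \o cinv (charts i)) }.

Definition transition (R : realType) (n : nat) (M : smooth_manifold R n)
    (i j : chart_index M) : 'rV[R]_n -> 'rV[R]_n :=
  cmap (charts j) \o cinv (charts i).

(* A tangent vector at p is a row vector, namely its components in the
   distinguished chart [chart_at p]; these are its components in the chart i. *)
Definition components (R : realType) (n : nat) (M : smooth_manifold R n)
    (i : chart_index M) (p : M) (u : 'rV[R]_n) : 'rV[R]_n :=
  u *m 'J (transition (chart_at p) i) (cmap (charts (chart_at p)) p).

(* Gram matrix, in the coordinate frame of the chart i at the point of
   coordinates x, of a field of bilinear forms g given in the charts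
   [chart_at p]. *)
Definition chart_gram (R : realType) (n : nat) (M : smooth_manifold R n)
    (g : M -> 'M[R]_n) (i : chart_index M) (x : 'rV[R]_n) : 'M[R]_n :=
  let p := cinv (charts i) x in
  let J := 'J (transition i (chart_at p)) x in
  J *m g p *m J^T.

Record riemannian_manifold (R : realType) (n : nat) := RiemannianManifold {
  manifold :> smooth_manifold R n;
  metric : manifold -> 'M[R]_n;
  metric_sym : forall p, (metric p)^T = metric p;
  metric_pos : forall p (u : 'rV[R]_n),
    u != 0 -> 0 < (u *m metric p *m u^T) 0 0;
  metric_smooth : forall i a b,
    smooth (cmap (charts i) @` cdom (charts i))
      (fun x => chart_gram metric i x a b : R^o) }.

Section Geometry.
Variables (R : realType) (n : nat) (M : riemannian_manifold R n).

Definition unit_vector (p : M) (u : 'rV[R]_n) : Prop :=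
  (u *m metric p *m u^T) 0 0 = 1.

Definition christoffel (i : chart_index M) (x : 'rV[R]_n) (k a b : 'I_n) : R :=
  let G := chart_gram (@metric R n M) i in
  let e (l : 'I_n) : 'rV[R]_n := delta_mx 0 l in
  2^-1 * \sum_(l < n) invmx (G x) k l *
    ('D_(e a) (fun y => G y l b : R^o) x
     + 'D_(e b) (fun y => G y l a : R^o) x
     - 'D_(e l) (fun y => G y a b : R^o) x).

Definition smooth_curve (a b : R) (c : R -> M) : Prop :=
  (forall s, a < s < b -> {for s, continuous c}) /\
  (forall i, smooth ([set s : R^o | a < s < b /\ cdom (charts i) (c s)])
     (fun s : R^o => cmap (charts i) (c s))).

Definition velocity (c : R -> M) (s : R) : 'rV[R]_n :=
  derive1 (fun r => cmap (charts (chart_at (c s))) (c r)) s.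

(* Levi-Civita covariant derivative D/ds of a vector field V along c, with
   V r in the tangent space at c r. *)
Definition covariant_derivative (c : R -> M) (V : R -> 'rV[R]_n) (s : R) :
    'rV[R]_n :=
  let i := chart_at (c s) in
  let x := cmap (charts i) (c s) in
  derive1 (fun r => components i (c r) (V r)) s
  + \row_k \sum_(a < n) \sum_(b < n)
      christoffel i x k a b * velocity c s 0 a * V s 0 b.

Definition is_geodesic (a b : R) (c : R -> M) : Prop :=
  smooth_curve a b c /\
  forall s, a < s < b -> covariant_derivative c (velocity c) s = 0.

(* [geodesic m v t] is gamma_v(t), and takes the junk value m when t lies
   outside the maximal interval of definition. *)
Definition geodesic (m : M) (v : 'rV[R]_n) (t : R) : M :=
  xget m [set p | exists a b (c : R -> M),
    [/\ a < 0 < b, a < t < b, is_geodesic a b c,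
        c 0 = m /\ velocity c 0 = v & c t = p]].

Definition exponential (m : M) (v : 'rV[R]_n) : M := geodesic m v 1.

Definition geodesic_sphere (m : M) (t : R) : set M :=
  [set p | exists2 w, unit_vector m w & p = exponential m (t *: w)].

(* For t below the injectivity radius at m, the vector w is unique. *)
Definition outward_normal (m : M) (t : R) (p : M) : 'rV[R]_n :=
  velocity (geodesic m (xget 0 [set w | unit_vector m w /\
                                        p = exponential m (t *: w)])) t.

Definition curve_in (S : set M) (p : M) (c : R -> M) : Prop :=
  exists2 e, 0 < e &
    [/\ smooth_curve (- e) e c, c 0 = p & forall s, - e < s < e -> S (c s)].

(* A is the matrix, in a basis (the rows of B) of the tangent space at p to the
   hypersurface S, of the shape operator X |-> - nabla_X N, where N is a unit
   normal field along S. *)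
Definition is_shape_matrix (S : set M) (N : M -> 'rV[R]_n) (p : M)
    (A : 'M[R]_n.-1) : Prop :=
  exists B : 'M[R]_(n.-1, n),
    [/\ row_free B,
        forall X : 'rV[R]_n, (X <= B)%MS <->
          exists2 c, curve_in S p c & velocity c 0 = X &
        forall (c : R -> M) (u : 'rV[R]_n.-1),
          curve_in S p c -> velocity c 0 = u *m B ->
          - covariant_derivative c (fun s => N (c s)) 0 = u *m A *m B].

(* The shape operator S_v(t), as its matrix in some basis of the tangent space
   at gamma_v(t) to the geodesic sphere of centre m and radius t; only
   basis-independent quantities are taken of it. *)
Definition shape_operator (m : M) (v : 'rV[R]_n) (t : R) : 'M[R]_n.-1 :=
  xget 0 (is_shape_matrix (geodesic_sphere m t) (outward_normal m t)
            (geodesic m v t)).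

End Geometry.

(* Eigenvalues with multiplicity, as roots of the characteristic polynomial in
   the algebraic closure R[i]; for a self-adjoint operator they are all real. *)
Definition eigenvalues (R : realType) (d : nat) (A : 'M[R]_d) : seq R[i] :=
  sval (closed_field_poly_normal (map_poly (real_complex R) (char_poly A))).

Definition elementary_symmetric (K : comNzRingType) (k : nat) (s : seq K) : K :=
  \sum_(I : {set 'I_(size s)} | #|I| == k) \prod_(i in I) s`_i.

Definition sigma (R : realType) (d k : nat) (A : 'M[R]_d) : R[i] :=
  elementary_symmetric k (eigenvalues A).

Definition datri_type (R : realType) (n : nat) (M : riemannian_manifold R n)
    (k : nat) : Prop :=
  forall m : M, exists2 eps : R, 0 < eps &
    forall t, 0 < t < eps -> forall v, unit_vector m v ->
      sigma k (shape_operator m v t) = sigma k (shape_operator m (- v) t).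

Definition SC_space (R : realType) (n : nat) (M : riemannian_manifold R n) :
    Prop :=
  forall m : M, exists2 eps : R, 0 < eps &
    forall t, 0 < t < eps -> forall v, unit_vector m v ->
      perm_eq (eigenvalues (shape_operator m v t))
              (eigenvalues (shape_operator m (- v) t)).

(* Main.v *)
Require Import Defs.
From mathcomp Require Import all_boot all_order all_algebra.
From mathcomp Require Import all_classical all_reals all_analysis.
From mathcomp Require Import complex.

(** The shape operator of a sphere at a point has n - 1 eigenvalues, and the
    elementary symmetric functions of d numbers are, up to sign, the
    coefficients of the monic polynomial of degree d having these numbers as
    its roots ([coef_prod_XsubC_elementary_symmetric]).  Hence two families of d
    elements of a field are permutations of each other if and only if their
    elementary symmetric functions of order 1, ..., d agree
    ([perm_eq_elementary_symmetric]); this is applied at every m, v and t to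
    the eigenvalues of S_v(t) and S_{-v}(t).

    What remains is to compare the radii below which the conditions hold: the
    D'Atri condition of each type k comes with its own radius at m, and as there
    are finitely many k, the smallest of these radii serves all of them
    ([common_radius]). *)

Import Order.TTheory GRing.Theory Num.Theory.
Local Open Scope ring_scope.

(** Vieta's formula: expanding the product over the set I of factors that
    contribute their root, the power of 'X that remains is [size s - #|I|]. *)
Lemma coef_prod_XsubC_elementary_symmetric (K : comNzRingType) (s : seq K)
    (k : nat) :
  (k <= size s)%N ->
  (\prod_(x <- s) ('X - x%:P))`_(size s - k) =
    (-1) ^+ k * elementary_symmetric k s.
Proof.
move=> le_ks; rewrite (big_nth 0) big_mkord.
under eq_bigr do rewrite addrC.
rewrite bigA_distr coef_sum /elementary_symmetric mulr_sumr [RHS]big_mkcond.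
apply: eq_bigr => I _.
have -> : \prod_(i < size s) (if i \in I then - (s`_i)%:P else 'X)
    = ((-1) ^+ #|I| * \prod_(i in I) s`_i)%:P * 'X^(size s - #|I|).
  rewrite (bigID (mem I)) /=; congr (_ * _).
    under eq_bigr => i iI do rewrite iI.
    by rewrite prodrN polyCM rmorphXn rmorphN1 rmorph_prod.
  under eq_bigr => i iNI do rewrite (negPf iNI).
  rewrite prodr_const; congr ('X ^+ _).
  by apply: (canRL (addKn _)); rewrite cardC card_ord.
have le_Is : (#|I| <= size s)%N by rewrite -[leqRHS]card_ord max_card.
rewrite coefCM coefXn.
have -> : (size s - k == size s - #|I|)%N = (#|I| == k).
  by rewrite eqn_sub2lE // eq_sym.
by case: eqP => [->|_]; rewrite ?mulr1 ?mulr0.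
Qed.

(** The sizes have to be equal because zeros appended to a sequence do not change
    its elementary symmetric functions. *)
Lemma perm_eq_elementary_symmetric (K : fieldType) (s t : seq K) :
  size s = size t ->
  perm_eq s t <->
  (forall k, (1 <= k <= size s)%N ->
     elementary_symmetric k s = elementary_symmetric k t).
Proof.
move=> est; split => [pst k /andP[_ le_ks] | eq_st].
  apply: (mulrI (unitrX k (unitrN1 K))).
  rewrite -!coef_prod_XsubC_elementary_symmetric -?est //.
  by rewrite (perm_big _ pst).
apply: prod_XsubC_eq; apply/polyP => j.
have [lt_sj | le_js] := ltnP (size s) j.
  by rewrite !nth_default // size_prod_XsubC -?est.
(* The coefficient of index size s belongs to the elementary symmetric function
   of order 0: it is the leading coefficient 1 of both products. *)
have [-> | ne_js] := eqVneq j (size s).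
  have lead (u : seq K) : (\prod_(x <- u) ('X - x%:P))`_(size u) = 1.
    have /monicP := monic_prod_XsubC u predT id.
    by rewrite /lead_coef size_prod_XsubC.
  by rewrite lead est lead.
have k_bounds : (1 <= size s - j <= size s)%N.
  by rewrite subn_gt0 ltn_neqAle ne_js le_js leq_subr.
rewrite -[j](subKn le_js) coef_prod_XsubC_elementary_symmetric ?leq_subr //.
rewrite eq_st // est coef_prod_XsubC_elementary_symmetric ?leq_subr //.
Qed.

Lemma size_eigenvalues (R : realType) (d : nat) (A : 'M[R]_d) :
  size (eigenvalues A) = d.
Proof.
rewrite /eigenvalues; case: closed_field_poly_normal => s /= def_p.
apply: succn_inj; rewrite -(size_prod_XsubC s id) -(size_char_poly A).
rewrite -(size_map_poly (real_complex R)) def_p size_scale //.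
rewrite lead_coef_map fmorph_eq0 lead_coef_eq0.
exact: monic_neq0 (char_poly_monic A).
Qed.

Lemma perm_eq_eigenvalues_sigma (R : realType) (d : nat) (A B : 'M[R]_d) :
  perm_eq (eigenvalues A) (eigenvalues B) <->
  (forall k, (1 <= k <= d)%N -> sigma k A = sigma k B).
Proof.
have := perm_eq_elementary_symmetric _ _ _
  (etrans (size_eigenvalues _ _ A) (esym (size_eigenvalues _ _ B))).
by rewrite size_eigenvalues.
Qed.

Lemma common_radius (R : realType) (I : finType) (P : I -> R -> Prop) :
  (forall i, exists2 eps, 0 < eps & forall t, 0 < t < eps -> P i t) ->
  exists2 eps, 0 < eps & forall t, 0 < t < eps -> forall i, P i t.
Proof.
move=> radius; pose r i := sval (cid2 (radius i)).
exists (\big[Order.min/1]_i r i).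
  by apply: lt_bigmin => // i _; rewrite /r; case: cid2.
move=> t /andP[t_gt0 lt_t] i.
have : t < r i by apply: lt_le_trans lt_t _; exact: bigmin_le.
by rewrite /r; case: cid2 => eps _ Peps /= lt_teps; apply: Peps; rewrite t_gt0.
Qed.

Theorem theorem5p2 (R : realType) (n : nat) (M : riemannian_manifold R n) :
  (forall k : nat, (1 <= k <= n - 1)%N -> datri_type M k) <-> SC_space M.
Proof.
split => [datri m | sc k kn m].
  pose same_sigma k t := forall v, unit_vector m v ->
    sigma k (shape_operator m v t) = sigma k (shape_operator m (- v) t).
  (* The bounds on k belong to the predicate, so that k may range over a finite
     type; a value of k outside them imposes nothing and accepts any radius. *)
  have [k | eps eps_gt0 Heps] := @common_radius R 'I_n.+1
      (fun k t => (1 <= k <= n - 1)%N -> same_sigma k t).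
    have [kn | kNn] := boolP (1 <= k <= n - 1)%N.
      have [eps eps_gt0 Heps] := datri k kn m.
      by exists eps => [//|t t_eps _]; exact: Heps t t_eps.
    by exists 1 => [|t _ kn]; [exact: ltr01 | case/negP: kNn].
  exists eps => [//|t t_eps v v1].
  apply/perm_eq_eigenvalues_sigma => k k_bounds.
  have kn : (1 <= k <= n - 1)%N by rewrite subn1.
  have lt_kn : (k < n.+1)%N.
    by case/andP: kn => _ /leq_trans; apply; exact: leq_subr.
  exact: Heps t t_eps (Ordinal lt_kn) kn v v1.
have [eps eps_gt0 Heps] := sc m; exists eps => [//|t t_eps v v1].
have /perm_eq_eigenvalues_sigma same := Heps t t_eps v v1.
have kn' : (1 <= k <= n.-1)%N by rewrite -subn1.
exact: same k kn'.
Qed.
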